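(* Let $\mathcal X=\{A_1,\dots,A_N\}$ be a collection of real matrices in $\mathbb{R}^{d_1\times d_2}$ with $\|A_i\|\le\sigma$ for all $i$, for some $\sigma>0$, and let $\mu=\frac1N\sum_{i=1}^NA_i$. Let $1\le n<N$ and let $X_1,\dots,X_n$ be drawn from $\mathcal X$ by sampling without replacement. Then for every $\epsilon>0$, $$P\Big(\Big\|\frac1n\sum_{i=1}^nX_i-\mu\Big\|\ge\epsilon\Big)\le2(d_1+d_2)\exp\Big(-\frac{n\epsilon^2}{8\sigma^2(1+1/n)(1-n/N)}\Big).$$
   Context: $\|\cdot\|$ is the spectral norm. Sampling without replacement: $(X_1,\dots,X_n)=(A_{\pi(1)},\dots,A_{\pi(n)})$ where $\pi$ is a uniformly random permutation of $\{1,\dots,N\}$. *)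

(* Defs.v *)
From Stdlib Require Import Reals ClassicalEpsilon.
From mathcomp Require Import all_boot perm.
Set Implicit Arguments. Unset Strict Implicit. Unset Printing Implicit Defensive.

Open Scope R_scope.

Definition rmat (d1 d2 : nat) := 'I_d1 -> 'I_d2 -> R.
Definition rvec (d : nat) := 'I_d -> R.

Definition rsum (n : nat) (f : 'I_n -> R) : R := \big[Rplus/0]_(i < n) f i.

Definition vnorm (d : nat) (x : rvec d) : R := sqrt (rsum (fun j => (x j)^2)).

Definition mxv (d1 d2 : nat) (A : rmat d1 d2) (x : rvec d2) : rvec d1 :=
  fun i => rsum (fun j => A i j * x j).

(* supremum of a set of reals (least upper bound); 0 if none exists *)
Definition Rsup (E : R -> Prop) : R :=
  match excluded_middle_informative (exists m, is_lub E m) with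
  | left h => proj1_sig (constructive_indefinite_description _ h)
  | right _ => 0
  end.

Definition specnorm (d1 d2 : nat) (A : rmat d1 d2) : R :=
  Rsup (fun r => exists x : rvec d2, vnorm x <= 1 /\ r = vnorm (mxv A x)).

Definition asb (P : Prop) : bool :=
  if excluded_middle_informative P then true else false.

Definition perm_prob (N : nat) (P : {perm 'I_N} -> Prop) : R :=
  INR #|[set s : {perm 'I_N} | asb (P s)]| / INR #|{perm 'I_N}|.

Definition mx_mean (N d1 d2 : nat) (A : 'I_N -> rmat d1 d2) : rmat d1 d2 :=
  fun i j => / INR N * rsum (fun k => A k i j).

(* empirical mean of X_k = A (s k), k < n : (1/n) sum_{k<n} A_{s(k)} *)
Definition sample_mean (N d1 d2 : nat) (n : nat) (A : 'I_N -> rmat d1 d2)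
  (s : {perm 'I_N}) : rmat d1 d2 :=
  fun i j => / INR n * \big[Rplus/0]_(k < N | (k < n)%N) A (s k) i j.

Definition mx_sub (d1 d2 : nat) (A B : rmat d1 d2) : rmat d1 d2 :=
  fun i j => A i j - B i j.

(* Main.v *)
Require Import Defs.
From Stdlib Require Import Reals Lra ClassicalEpsilon.
From mathcomp Require Import all_boot perm.
Set Implicit Arguments. Unset Strict Implicit. Unset Printing Implicit Defensive.

(** Let [T_k] be the mean of the first [k] samples, so [T_N = mu]. Read backwards
    from [k = N] to [k = n], [T_k] is a martingale: its increment is
    [T_k - T_(k+1) = (T_(k+1) - X_(k+1)) / k], of norm at most [2 sigma / k]. After
    passing to Hermitian dilations, the [2p]-th trace moment of [M + D], for a centered
    [D] of norm at most [c], is dominated by the one obtained when [D] is replaced by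
    [c] times an independent random sign; this is a comparison of second derivatives
    along [t |-> M + t D], and replaces Golden-Thompson. Iterating, the trace moments
    of [T_n - mu] are at most [d1 + d2] times those of a Gaussian of variance
    [sum_(n <= k < N) 4 sigma^2 / k^2 <= 4 sigma^2 (1 + 1/n) (1 - n/N) / n],
    and summing the series of [cosh] gives the tail bound, with the factor [2] coming
    from [exp y <= 2 cosh y]. *)

Open Scope R_scope.

(** * Power series of [cosh] and Gaussian tails *)

Lemma pow_double y p : y ^ p.*2 = (y ^ 2) ^ p.
Proof. by rewrite -mul2n -multE pow_mult. Qed.

(** Odd powers cancel between [y] and [- y]; each induction step adds one even and one odd degree,
    leaving twice a partial sum of [cosh]. *)
Lemma E1_even_part y K :
  E1 y K.*2.+1 + E1 (- y) K.*2.+1 =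
  2 * sum_f_R0 (fun p => (y ^ 2) ^ p / INR (Factorial.fact p.*2)) K.
Proof.
rewrite /E1; elim: K => [|K IH]; first by simpl; field.
rewrite doubleS !(tech5 _ K.*2.+2) !(tech5 _ K.*2.+1) (tech5 _ K) Rmult_plus_distr_l -IH.
rewrite -!(tech_pow_Rmult _ K.*2.+2) -!doubleS !pow_double.
have -> : (- y) ^ 2 = y ^ 2 by ring.
by rewrite /Rdiv; ring.
Qed.

Lemma Un_cv_odd_le u l c :
  Un_cv u l -> (forall K, u K.*2.+1 <= c) -> l <= c.
Proof.
move=> hu hc; apply: Rnot_lt_le => lc.
have [K hK] := hu (l - c) ltac:(lra).
have /hK : (K.*2.+1 >= K)%coq_nat by apply/leP; rewrite -addnn leqW ?leq_addr.
by have := hc K; rewrite /Rdist => h /Rabs_def2 [_]; lra.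
Qed.

Lemma E1_le_exp x K : 0 <= x -> E1 x K <= exp x.
Proof.
move=> x0; apply: growing_ineq (E1_cvg x) _ => k.
rewrite /E1 tech5 -[X in X <= _]Rplus_0_r; apply: Rplus_le_compat_l.
apply: Rmult_le_pos; last exact: pow_le.
exact/Rlt_le/Rinv_0_lt_compat/INR_fact_lt_0.
Qed.

(* Exponentiate: summing the hypothesis with weights [(e / v)^(2p)] compares
   [P cosh (e^2 / v)] with [d exp (e^2 / (2 v))]. *)
Lemma gaussian_moments_tail P d v e : 0 <= P -> 0 <= d -> 0 < v ->
  (forall p, P * ((e ^ 2) ^ p / INR (Factorial.fact p.*2)) <=
             d * ((v / 2) ^ p / INR (Factorial.fact p))) ->
  P <= 2 * d * exp (- (e ^ 2 / (2 * v))).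
Proof.
move=> P0 d0 v0 hm.
set w := e ^ 2 / (2 * v); pose y := e ^ 2 / v.
have w0 : 0 <= w.
  by apply: Rmult_le_pos; [exact: pow2_ge_0 | apply/Rlt_le/Rinv_0_lt_compat; lra].
have term p : P * ((y ^ 2) ^ p / INR (Factorial.fact p.*2)) <=
              d * (/ INR (Factorial.fact p) * w ^ p).
  have -> : (y ^ 2) ^ p = ((e / v) ^ 2) ^ p * (e ^ 2) ^ p.
    by rewrite -Rpow_mult_distr /y; congr (_ ^ _); field; lra.
  have -> : w ^ p = ((e / v) ^ 2) ^ p * (v / 2) ^ p.
    by rewrite -Rpow_mult_distr /w; congr (_ ^ _); field; lra.
  have q0 : 0 <= ((e / v) ^ 2) ^ p by apply/pow_le/pow2_ge_0.
  by have := Rmult_le_compat_l _ _ _ q0 (hm p); rewrite /Rdiv; lra.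
have cosh_le : P * (exp y + exp (- y)) <= 2 * d * exp w.
  apply: (@Un_cv_odd_le (fun n => P * (E1 y n + E1 (- y) n))).
    apply: CV_mult; last by apply: CV_plus; exact: E1_cvg.
    by move=> eps eps0; exists 0%N => n _; rewrite /Rdist Rminus_diag Rabs_R0.
  move=> K; rewrite E1_even_part.
  have h : P * sum_f_R0 (fun p => (y ^ 2) ^ p / INR (Factorial.fact p.*2)) K
      <= d * E1 w K.
    rewrite /E1 !scal_sum; apply: sum_Rle => p _.
    by rewrite ![_ * P]Rmult_comm ![_ * d]Rmult_comm.
  have := Rmult_le_compat_l _ _ _ d0 (E1_le_exp K w0); lra.
(* Since [y = 2 w], dividing [P exp y <= 2 d exp w] by [exp y] leaves the rate [exp (- w)]. *)
have -> : exp (- w) = exp w * exp (- y).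
  by rewrite -exp_plus; congr exp; rewrite /w /y; field; lra.
have yy : exp y * exp (- y) = 1 by rewrite -exp_plus Rplus_opp_r exp_0.
have ey := exp_pos (- y).
have h : P * exp y <= 2 * d * exp w.
  by have := Rmult_le_pos _ _ P0 (Rlt_le _ _ ey); lra.
have := Rmult_le_compat_r _ _ _ (Rlt_le _ _ ey) h.
by rewrite Rmult_assoc yy; lra.
Qed.

(** Here [x], [y], [s2], [e] stand for [n], [N], [sigma ^ 2], [eps ^ 2]; the positive quantity is
    the variance later named [vproxy]. *)
Lemma exponent_vproxy (x y s2 e : R) : 0 < x < y -> 0 < s2 ->
  0 < 4 * s2 * ((x + 1) * (y - x) / (x ^ 2 * y)) /\
  - (x * e) / (8 * s2 * (1 + / x) * (1 - x / y)) =
  - (e / (2 * (4 * s2 * ((x + 1) * (y - x) / (x ^ 2 * y))))).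
Proof.
move=> xy s0; split; last by field; lra.
apply: Rmult_lt_0_compat; first lra.
by apply: Rdiv_lt_0_compat; apply: Rmult_lt_0_compat; try lra; apply: pow_lt; lra.
Qed.

From mathcomp Require Import all_order all_fingroup all_algebra.
From mathcomp Require Import polyrcf ring lra zify Rstruct.
Import Order.TTheory GRing.Theory Num.Theory.

(** * Trace moments of symmetric matrices *)

Section MatrixMoments.
Local Open Scope ring_scope.
Variable R : rcfType.

(** Squared Frobenius norm, hence the squared Euclidean norm on columns. *)
Definition frob m n (X : 'M[R]_(m, n)) : R := \tr (X^T *m X).

Lemma frobE m n (X : 'M[R]_(m, n)) : frob X = \sum_j \sum_i X i j ^+ 2.
Proof.
by apply: eq_bigr => j _; rewrite mxE; apply: eq_bigr => i _; rewrite mxE expr2.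
Qed.

Lemma frob_ge0 m n (X : 'M[R]_(m, n)) : 0 <= frob X.
Proof. by rewrite frobE; do 2!apply: sumr_ge0 => ? _; exact: sqr_ge0. Qed.

Lemma trmx_mul_comm_tr m n (X Y : 'M[R]_(m, n)) : \tr (X^T *m Y) = \tr (Y^T *m X).
Proof. by rewrite -mxtrace_tr trmx_mul trmxK. Qed.

Lemma frobD m n (X Y : 'M[R]_(m, n)) :
  frob (X + Y) = frob X + 2 * \tr (X^T *m Y) + frob Y.
Proof.
rewrite /frob [(X + Y)^T]linearD /= mulmxDl !mulmxDr !mxtraceD (trmx_mul_comm_tr Y X); ring.
Qed.

Lemma frobZ m n a (X : 'M[R]_(m, n)) : frob (a *: X) = a ^+ 2 * frob X.
Proof. by rewrite /frob [(a *: X)^T]linearZ /= -scalemxAl -scalemxAr !mxtraceZ mulrA expr2. Qed.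

Lemma frobN m n (X : 'M[R]_(m, n)) : frob (- X) = frob X.
Proof. by rewrite -scaleN1r frobZ sqrrN expr1n mul1r. Qed.

Lemma frobB m n (X Y : 'M[R]_(m, n)) :
  frob (X - Y) = frob X - 2 * \tr (X^T *m Y) + frob Y.
Proof. by rewrite frobD frobN mulmxN linearN /= mulrN. Qed.

Lemma trmx_mul_le m n (X Y : 'M[R]_(m, n)) :
  2 * \tr (X^T *m Y) <= frob X + frob Y.
Proof. have := frob_ge0 (X - Y); rewrite frobB; lra. Qed.

Lemma frob_sub_le m n (X Y : 'M[R]_(m, n)) : frob (X - Y) <= 2 * (frob X + frob Y).
Proof. have := frob_ge0 (X + Y); rewrite frobB frobD; lra. Qed.

Lemma frob_sum_le m n p (X : 'I_p -> 'M[R]_(m, n)) :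
  frob (\sum_i X i) <= p%:R * \sum_i frob (X i).
Proof.
elim: p X => [|p IH] X; first by rewrite big_ord0 /frob mulmx0 mxtrace0 mul0r.
case: p IH X => [|p] IH X; first by rewrite !big_ord1 mul1r.
rewrite big_ord_recr [in leRHS]big_ord_recr /= -[p.+2%:R]natr1.
have := IH (fun i => X (widen_ord (leqnSn p.+1) i)).
set S := \sum_(i < p.+1) X _; set F := \sum_(i < p.+1) frob _; set q : R := p.+1%:R.
have q0 : 0 < q by rewrite ltr0n.
(* The weight [q] balances the cross term: it becomes at most [F + q |X|^2], exactly what is missing
   from [(q + 1) (F + |X|^2)]. *)
have := trmx_mul_le S (q *: X ord_max).
rewrite -scalemxAr mxtraceZ frobZ frobD => h hS.
have {}h : 2 * \tr (S^T *m X ord_max) <= F + q * frob (X ord_max).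
  by rewrite -(ler_pM2l q0); move: h hS; nra.
by move: hS h; nra.
Qed.

Lemma frob_col m n (X : 'M[R]_(m, n)) : frob X = \sum_j frob (col j X).
Proof.
rewrite frobE; apply: eq_bigr => j _; rewrite frobE big_ord1.
by apply: eq_bigr => i _; rewrite mxE.
Qed.

(** Stated with squares: [c2] is the square of a bound on the operator norm. *)
Definition opbound n (c2 : R) (D : 'M[R]_n) :=
  forall x : 'cV[R]_n, frob (D *m x) <= c2 * frob x.

Lemma opbound_mulmx n p c2 (D : 'M[R]_n) (X : 'M[R]_(n, p)) :
  opbound c2 D -> frob (D *m X) <= c2 * frob X.
Proof.
move=> hD; rewrite frob_col (frob_col X) mulr_sumr; apply: ler_sum => j _.
by rewrite colE -mulmxA -colE.
Qed.

Lemma exprmx_sym n (A : 'M[R]_n) k : A^T = A -> (A ^+ k)^T = A ^+ k.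
Proof.
move=> hA; elim: k => [|k IH]; first by rewrite !expr0 trmx1.
by rewrite exprS -mulmxE trmx_mul IH hA mulmxE -exprSr exprS.
Qed.

(** A discrete maximum principle: once a convex sequence exceeds [h 0] it keeps rising, so it cannot
    be back at [h 0] at index [k]. *)
Lemma discrete_convex_le (h : nat -> R) k :
  (forall p, (0 < p < k)%N -> 2 * h p <= h p.-1 + h p.+1) ->
  h k = h 0%N -> forall p, (p <= k)%N -> h p <= h 0%N.
Proof.
move=> hc hk.
have inc p : (p < k)%N -> h 0%N < h p -> h p < h p.+1.
  elim: p => [|p IH] pk; first by rewrite ltxx.
  move=> h0; have := hc p.+1; rewrite pk /= => /(_ isT).
  have [le0|gt0] := leP (h p) (h 0%N); first by lra.
  by have := IH (ltnW pk) gt0; lra.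
move=> p pk; rewrite leNgt; apply/negP => h0.
suff : forall j, (p + j <= k)%N -> h 0%N < h (p + j)%N.
  by move/(_ (k - p)%N); rewrite subnKC // hk ltxx => /(_ (leqnn _)).
elim=> [|j IH] pj; first by rewrite addn0.
rewrite addnS in pj *.
by apply: lt_trans (IH (ltnW pj)) _; apply: inc => //; exact: IH (ltnW pj).
Qed.

Lemma trace_exprD n (A D : 'M[R]_n) a b c e : A^T = A -> D^T = D ->
  \tr ((A ^+ a * D * A ^+ b)^T *m (A ^+ c * D * A ^+ e)) =
  \tr (D * A ^+ (a + c) * D * A ^+ (b + e)).
Proof.
move=> hA hD; rewrite -!mulmxE !trmx_mul hD !exprmx_sym // !mulmxE.
rewrite [LHS](_ : _ = \tr (A ^+ b *m (D * A ^+ (a + c) * D * A ^+ e))); last first.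
  by rewrite mulmxE exprD !mulrA.
by rewrite mxtrace_mulC mulmxE (addnC b) (exprD _ e) mulrA.
Qed.

(* Convexity of [i |-> tr (D A^i D A^(2m-i))] on the even integers, by Cauchy-Schwarz,
   and its symmetry [i <-> 2m - i]. *)
Lemma trace_mixed_le n (A D : 'M[R]_n) m i : A^T = A -> D^T = D -> (i <= m.*2)%N ->
  \tr (D * A ^+ i * D * A ^+ (m.*2 - i)) <= \tr (D * D * A ^+ m.*2).
Proof.
move=> hA hD him.
pose h p := frob (A ^+ p * D * A ^+ (m - p)).
have cs p q : (p <= m)%N -> (q <= m)%N ->
    2 * \tr (D * A ^+ (p + q) * D * A ^+ (m.*2 - (p + q))) <= h p + h q.
  move=> pm qm; have := trmx_mul_le (A ^+ p * D * A ^+ (m - p)) (A ^+ q * D * A ^+ (m - q)).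
  by rewrite trace_exprD // (_ : m - p + (m - q) = m.*2 - (p + q))%N //; lia.
have hE p : (p <= m)%N -> h p = \tr (D * A ^+ p.*2 * D * A ^+ (m.*2 - p.*2)).
  move=> pm; rewrite /h /frob trace_exprD // addnn.
  by rewrite (_ : m - p + (m - p) = m.*2 - p.*2)%N //; lia.
have h0 : h 0%N = \tr (D * D * A ^+ m.*2) by rewrite hE // expr0 mulr1 subn0.
have hle p : (p <= m)%N -> h p <= h 0%N.
  apply: discrete_convex_le => [q /andP[q0 qm]|].
    have := cs q.-1 q.+1; rewrite (_ : q.-1 + q.+1 = q.*2)%N; last by lia.
    by rewrite (hE q); [apply; lia | lia].
  rewrite h0 hE // subnn expr0 mulr1 -mulrA -mulmxE mxtrace_mulC mulmxE.
  by rewrite -mulrA -mulmxE mxtrace_mulC.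
rewrite -h0.
(* Splitting [i] into its two halves covers odd [i] as well: [cs] bounds the trace by an average of
   two values of [h]. *)
have := cs i./2 (uphalf i).
have -> : (i./2 + uphalf i = i)%N by lia.
have h1 : (i./2 <= m)%N by lia.
have h2 : (uphalf i <= m)%N by lia.
by move/(_ h1 h2); have := hle _ h1; have := hle _ h2; lra.
Qed.

(** * Derivatives of trace powers along a line *)

Lemma poly_deriv_ge0 (p : {poly R}) : 0 <= p.[0] ->
  (forall t, 0 <= t -> 0 <= p^`().[t]) -> forall t, 0 <= t -> 0 <= p.[t].
Proof.
move=> p0 hp t t0; apply: (le_trans p0).
apply: (@ler_hornerW R 0 t p) => //; rewrite ?in_itv /= ?lexx ?t0 //.
by move=> x; rewrite in_itv /= => /andP[/ltW x0 _]; exact: hp.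
Qed.

Definition dmx m n (P : 'M[{poly R}]_(m, n)) := map_mx (@deriv R) P.

Lemma dmxM m n p (P : 'M[{poly R}]_(m, n)) (Q : 'M_(n, p)) :
  dmx (P *m Q) = dmx P *m Q + P *m dmx Q.
Proof.
apply/matrixP => i j; rewrite !mxE raddf_sum /= -big_split /=.
by apply: eq_bigr => k _; rewrite derivM !mxE.
Qed.

Lemma dmxX n (P : 'M[{poly R}]_n) k :
  dmx (P ^+ k) = \sum_(i < k) P ^+ i * dmx P * P ^+ (k - i.+1).
Proof.
elim: k => [|k IH].
  rewrite big_ord0; apply/matrixP => i j; rewrite !mxE.
  by rewrite mulrb; case: ifP; rewrite ?derivC ?deriv0 // -polyC1 derivC.
rewrite exprSr [dmx _]dmxM IH !mulmxE big_ord_recr /= subnn expr0 mulr1; congr (_ + _).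
rewrite mulr_suml; apply: eq_bigr => i _.
by rewrite -mulrA -exprSr subSn.
Qed.

Lemma deriv_trace n (P : 'M[{poly R}]_n) : (\tr P)^`() = \tr (dmx P).
Proof. by rewrite /mxtrace raddf_sum; apply: eq_bigr => i _; rewrite mxE. Qed.

(** By cyclicity of the trace, all [k] terms of the noncommutative product rule coincide. *)
Lemma deriv_traceX n (P : 'M[{poly R}]_n) k :
  (\tr (P ^+ k))^`() = \tr (dmx P * P ^+ k.-1) *+ k.
Proof.
rewrite deriv_trace dmxX raddf_sum /=.
under eq_bigr => i _.
  rewrite -mulrA -mulmxE mxtrace_mulC mulmxE -mulrA -exprD.
  rewrite (_ : k - i.+1 + i = k.-1)%N; last by have := ltn_ord i; lia.
  over.
by rewrite sumr_const card_ord.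
Qed.

Lemma deriv_trace_mulX n (E P : 'M[{poly R}]_n) k : dmx E = 0 ->
  (\tr (E * P ^+ k))^`() = \sum_(i < k) \tr (E * P ^+ i * dmx P * P ^+ (k - i.+1)).
Proof.
move=> hE; rewrite deriv_trace -mulmxE dmxM hE mul0mx add0r dmxX mulmxE mulr_sumr.
by rewrite raddf_sum /=; apply: eq_bigr => i _; rewrite !mulrA.
Qed.

(** Encoding the line as a matrix of polynomials makes differentiation along it purely algebraic. *)
Definition linepath n (M D : 'M[R]_n) : 'M[{poly R}]_n :=
  map_mx polyC M + 'X *: map_mx polyC D.

Lemma dmx_linepath n (M D : 'M[R]_n) : dmx (linepath M D) = map_mx polyC D.
Proof.
apply/matrixP => i j.
by rewrite !mxE derivD derivC add0r derivM derivX derivC mulr0 addr0 mul1r.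
Qed.

Lemma dmx_polyC n (D : 'M[R]_n) : dmx (map_mx polyC D) = 0.
Proof. by apply/matrixP => i j; rewrite !mxE derivC. Qed.

Lemma linepath_horner n (M D : 'M[R]_n) t :
  map_mx (horner_eval t) (linepath M D) = M + t *: D.
Proof.
by apply/matrixP => i j; rewrite !mxE /horner_eval hornerD hornerM hornerX !hornerC.
Qed.

Lemma horner_trace n (P : 'M[{poly R}]_n) t :
  (\tr P).[t] = \tr (map_mx (horner_eval t) P).
Proof. by rewrite trace_map_mx. Qed.

Lemma horner_polyC_mx n (D : 'M[R]_n) t :
  map_mx (horner_eval t) (map_mx polyC D) = D.
Proof. by apply/matrixP => i j; rewrite !mxE /horner_eval hornerC. Qed.

(** Up to a factor, the second derivative is a sum of traces [tr (D A^i D A^(2p-i))]. Each is at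
    most the one with the two copies of [D] adjacent, which is the squared Frobenius norm of
    [D A^p]. *)
Lemma trace_line_deriv2_le n (M D : 'M[R]_n) c2 p t :
  M^T = M -> D^T = D -> opbound c2 D ->
  (\tr (linepath M D ^+ p.+1.*2))^`()^`().[t] <=
  c2 * \tr ((M + t *: D) ^+ p.*2) *+ (p.+1.*2 * p.*2.+1).
Proof.
move=> hM hD hc.
rewrite deriv_traceX dmx_linepath derivMn deriv_trace_mulX ?dmx_polyC //.
rewrite hornerMn mulnC mulrnA doubleS; rewrite ler_wMn2r //.
rewrite horner_sum /=.
set A := M + t *: D.
have hA : A^T = A by rewrite /A linearD linearZ /= hM hD.
have -> : c2 * \tr (A ^+ p.*2) *+ p.*2.+1 = \sum_(i < p.*2.+1) c2 * \tr (A ^+ p.*2).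
  by rewrite sumr_const card_ord.
apply: ler_sum => i _.
rewrite horner_trace !rmorphM /= !rmorphXn /= dmx_linepath.
rewrite linepath_horner !horner_polyC_mx -/A subSS.
apply: (le_trans (trace_mixed_le hA hD _)); first by have := ltn_ord i; lia.
have -> : \tr (D * D * A ^+ p.*2) = frob (D *m A ^+ p).
  rewrite /frob trmx_mul hD exprmx_sym // mulmxE.
  have -> : A ^+ p * D * (D * A ^+ p) = A ^+ p *m (D * D * A ^+ p) by rewrite mulmxE !mulrA.
  by rewrite [RHS]mxtrace_mulC mulmxE -addnn exprD mulrA.
have -> : \tr (A ^+ p.*2) = frob (A ^+ p) by rewrite /frob exprmx_sym // mulmxE -exprD addnn.
exact: opbound_mulmx.
Qed.

(** With the [cosh] coefficient [1 / (2p)!], two derivatives in [t] lower [p] by one without leaving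
    a numerical factor. *)
Definition nmoment n p (A : 'M[R]_n) : R := (p.*2)`!%:R^-1 * \tr (A ^+ p.*2).

(* The right-hand side is the normalised moment of [M + t c e] for an independent
   random sign [e]. Both sides are polynomials in [t]; they agree to first order
   at [0], and the second derivatives compare by induction on [p]. *)
Lemma mean_nmoment_le n (I : finType) (M : 'M[R]_n) (D : I -> 'M[R]_n) c2 p :
  M^T = M -> (forall i, (D i)^T = D i) -> (forall i, opbound c2 (D i)) -> 0 <= c2 ->
  \sum_i D i = 0 ->
  forall t, 0 <= t ->
  \sum_i nmoment p (M + t *: D i) <=
  #|I|%:R * \sum_(l < p.+1) (c2 * t ^+ 2) ^+ l / (l.*2)`!%:R * nmoment (p - l) M.
Proof.
move=> hM hD hc c0 hS.
pose psi p : {poly R} := \sum_i (p.*2)`!%:R^-1 *: \tr (linepath M (D i) ^+ p.*2).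
pose beta p : {poly R} := \sum_(l < p.+1)
  (#|I|%:R * (c2 ^+ l / (l.*2)`!%:R * nmoment (p - l) M)) *: ('X^(l.*2) : {poly R}).
have psiE q t : (psi q).[t] = \sum_i nmoment q (M + t *: D i).
  rewrite /psi horner_sum; apply: eq_bigr => i _.
  by rewrite hornerZ horner_trace rmorphXn /= linepath_horner.
have betaE q t : (beta q).[t] =
    #|I|%:R * \sum_(l < q.+1) (c2 * t ^+ 2) ^+ l / (l.*2)`!%:R * nmoment (q - l) M.
  rewrite /beta horner_sum mulr_sumr; apply: eq_bigr => l _.
  by rewrite hornerZ hornerXn exprMn -exprM mul2n; ring.
have beta2 q : (beta q.+1)^`()^`() = c2 *: beta q.
  rewrite /beta big_ord_recl /= !derivE raddf_sum /= raddf_sum /= scaler_sumr.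
  rewrite scaler0 add0r.
  apply: eq_bigr => l _; rewrite /bump /= add1n subSS doubleS.
  rewrite !derivZ !derivXn !derivMn derivXn /= -mulrnA -scaler_nat !scalerA; congr (_ *: _).
  rewrite !factS !natrM.
  have : (l.*2)`!%:R != 0 :> R by rewrite pnatr_eq0 -lt0n fact_gt0.
  have : l.*2.+1%:R != 0 :> R by rewrite pnatr_eq0.
  have : l.*2.+2%:R != 0 :> R by rewrite pnatr_eq0.
  move: _%:R _%:R _`!%:R #|I|%:R (nmoment _ _) => a b f k m a0 b0 f0.
  by rewrite exprS; field; rewrite a0 b0 f0.
suff H q t : 0 <= t -> 0 <= (beta q - psi q).[t].
  by move=> t t0; rewrite -psiE -betaE -subr_ge0 -hornerN -hornerD; exact: H.
elim: q t => [|q IH] t t0.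
  rewrite hornerD hornerN subr_ge0 psiE betaE big_ord1 /nmoment /=.
  under eq_bigr do rewrite expr0.
  by rewrite sumr_const -[leLHS]mulr_natl !expr0 fact0 invr1 !mul1r.
apply: poly_deriv_ge0 t0 => [|{}t t0].
  rewrite hornerD hornerN subr_ge0 psiE betaE big_ord_recl /= expr0 fact0 invr1 !mul1r.
  rewrite subn0 [\sum_(_ < _) _]big1 => [|i _]; last by rewrite expr2 !mulr0 exprS !mul0r.
  by under eq_bigr do rewrite scale0r addr0; rewrite sumr_const addr0 mulr_natl.
apply: poly_deriv_ge0 t0 => [|{}t t0].
  rewrite derivB hornerD hornerN subr_ge0.
  (* [beta] has only even powers of [t]; the derivative of [psi] at 0 is linear in the sum of the
     [D i], which is zero. *)
  have -> : (beta q.+1)^`().[0] = 0.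
    rewrite /beta raddf_sum horner_sum big1 // => -[[|l] hl] _ /=.
      by rewrite derivZ derivC scaler0 horner0.
    rewrite doubleS derivZ derivXn hornerZ hornerMn hornerXn expr0n.
    by rewrite mul0rn mulr0.
  rewrite /psi raddf_sum horner_sum /=.
  under eq_bigr => i _.
    rewrite derivZ deriv_traceX hornerZ hornerMn horner_trace rmorphM rmorphXn /=.
    rewrite linepath_horner dmx_linepath horner_polyC_mx scale0r addr0.
    over.
  by rewrite -mulr_sumr sumrMnl -raddf_sum -mulr_suml hS mul0r raddf0 mul0rn mulr0.
rewrite !derivB hornerD hornerN beta2 subr_ge0 hornerZ.
(* The induction hypothesis bounds [c2 * psi q] by [c2 * beta q]; the second-derivative bound
   supplies the other half. *)
apply: (@le_trans _ _ (c2 * (psi q).[t])); last first.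
  by rewrite ler_wpM2l // -subr_ge0 -hornerN -hornerD IH.
rewrite psiE /psi !raddf_sum /= horner_sum mulr_sumr; apply: ler_sum => i _.
rewrite !derivZ hornerZ.
apply: (le_trans (ler_wpM2l _ (trace_line_deriv2_le q t hM (hD i) (hc i)))).
  by rewrite invr_ge0 ler0n.
rewrite /nmoment -[c2 * _ *+ _]mulr_natr doubleS !factS !natrM.
have : (q.*2)`!%:R != 0 :> R by rewrite pnatr_eq0 -lt0n fact_gt0.
have : q.*2.+1%:R != 0 :> R by rewrite pnatr_eq0.
have : q.*2.+2%:R != 0 :> R by rewrite pnatr_eq0.
move: _%:R _%:R _`!%:R (\tr _) => a b f m a0 b0 f0.
by rewrite le_eqVlt; apply/orP; left; apply/eqP; field; rewrite a0 b0 f0.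
Qed.

(** * Sampling without replacement *)

Definition partial_mean N m n (H : 'I_N -> 'M[R]_(m, n)) k (s : {perm 'I_N}) :=
  k%:R^-1 *: \sum_(i < N | (i < k)%N) H (s i).

Lemma partial_mean_full N m n (H : 'I_N -> 'M[R]_(m, n)) s :
  partial_mean H N s = N%:R^-1 *: \sum_i H i.
Proof.
rewrite /partial_mean [in RHS](reindex_perm s); congr (_ *: _).
by apply: eq_bigl => i; rewrite ltn_ord.
Qed.

(** Composing with [tperm j k] moves the sample at position [j] to position [k], so it is the one
    dropped in passing from [k + 1] samples to [k]. *)
Lemma partial_mean_tperm N m n (H : 'I_N -> 'M[R]_(m, n)) (k j : 'I_N) s :
  (0 < k)%N -> (j <= k)%N ->
  partial_mean H k (tperm j k * s)%g = partial_mean H k.+1 s +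
    k%:R^-1 *: (partial_mean H k.+1 s - H (s j)).
Proof.
move=> k0 jk.
have kR : k%:R != 0 :> R by rewrite pnatr_eq0 -lt0n.
have k1R : k.+1%:R != 0 :> R by rewrite pnatr_eq0.
have sumE : \sum_(i < N | (i < k.+1)%N) H ((tperm j k * s)%g i) =
    \sum_(i < N | (i < k.+1)%N) H (s i).
  rewrite [RHS](reindex_perm (tperm j k)) /=.
  apply: eq_big => i; last by rewrite permM.
  by case: tpermP => [->|->|] //; rewrite !ltnS leqnn jk.
have -> : partial_mean H k (tperm j k * s)%g =
    k%:R^-1 *: (k.+1%:R *: partial_mean H k.+1 s - H (s j)).
  rewrite /partial_mean scalerA mulfV // scale1r -sumE [in RHS](bigD1 k) //=.
  rewrite permM tpermR addrAC subrr add0r; congr (_ *: _).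
  apply: eq_bigl => i; rewrite ltnS andbC.
  by rewrite ltn_neqAle -val_eqE.
rewrite scalerBr scalerBr scalerA -natr1 mulrDr mulVf // mulr1 scalerDl scale1r.
by rewrite addrA.
Qed.

Lemma sum_partial_mean N m n (H : 'I_N -> 'M[R]_(m, n)) k s (hk : (k.+1 <= N)%N) :
  \sum_(j < k.+1) (partial_mean H k.+1 s - H (s (widen_ord hk j))) = 0.
Proof.
rewrite sumrB sumr_const card_ord /partial_mean big_ord_narrow -scaler_nat scalerA.
by rewrite mulfV ?pnatr_eq0 // scale1r subrr.
Qed.

Lemma opbound_partial_mean N n (H : 'I_N -> 'M[R]_n) s2 k s :
  (forall i, opbound s2 (H i)) -> (k.+1 <= N)%N -> opbound s2 (partial_mean H k.+1 s).
Proof.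
move=> hH hk x; rewrite /partial_mean -scalemxAl frobZ big_ord_narrow mulmx_suml.
apply: (@le_trans _ _ (k.+1%:R^-1 ^+ 2 * (k.+1%:R * \sum_(j < k.+1) (s2 * frob x)))).
  rewrite ler_wpM2l ?sqr_ge0 //; apply: le_trans (frob_sum_le _) _.
  by rewrite ler_wpM2l //; apply: ler_sum => j _; exact: hH.
rewrite sumr_const card_ord -[_ * frob x *+ _]mulr_natl.
have : k.+1%:R != 0 :> R by rewrite pnatr_eq0.
by move: k.+1%:R => q q0; rewrite le_eqVlt; apply/orP; left; apply/eqP; field.
Qed.

Lemma trmx_partial_mean N n (H : 'I_N -> 'M[R]_n) k s :
  (forall i, (H i)^T = H i) -> (partial_mean H k s)^T = partial_mean H k s.
Proof.
move=> hH; rewrite /partial_mean linearZ /= linear_sum /=; congr (_ *: _).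
exact: eq_bigr.
Qed.

(** Left unnormalised: [N!] times an expectation. *)
Definition sum_nmoment N n (H : 'I_N -> 'M[R]_n) p k :=
  \sum_(s : {perm 'I_N}) nmoment p (partial_mean H k s - N%:R^-1 *: \sum_i H i).

(* Reverse martingale step: given the set of the first [k + 1] samples, the one left
   out of the first [k] is uniform; composing with [tperm j k] averages over it. *)
Lemma sum_nmoment_step N n (H : 'I_N -> 'M[R]_n) s2 p k :
  (forall i, (H i)^T = H i) -> (forall i, opbound s2 (H i)) -> 0 <= s2 ->
  (0 < k < N)%N ->
  sum_nmoment H p k <= \sum_(l < p.+1)
    (4 * s2 / k%:R ^+ 2) ^+ l / (l.*2)`!%:R * sum_nmoment H (p - l) k.+1.
Proof.
move=> hsym hH s0 /andP[k0 hk].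
pose mu := N%:R^-1 *: \sum_i H i.
pose T s := partial_mean H k.+1 s.
pose D s j := k%:R^-1 *: (T s - H (s (widen_ord hk j))).
have kR : k%:R != 0 :> R by rewrite pnatr_eq0 -lt0n.
have kk : 0 < k.+1%:R :> R by rewrite ltr0n.
have avg : k.+1%:R * sum_nmoment H p k =
    \sum_s \sum_(j < k.+1) nmoment p (T s - mu + 1 *: D s j).
  rewrite exchange_big /=.
  rewrite -[k.+1 in LHS]card_ord mulr_natl -sumr_const; apply: eq_bigr => j _.
  (* Left multiplication by a transposition permutes the group, so every [j] contributes the same
     total. *)
  rewrite /sum_nmoment (reindex_inj (mulgI (tperm (widen_ord hk j) (Ordinal hk)))) /=.
  apply: eq_bigr => s _; congr (nmoment _ _).
  rewrite (@partial_mean_tperm _ _ _ H (Ordinal hk)) //=; last by rewrite -ltnS.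
  by rewrite scale1r -/(T s) -/mu addrAC.
rewrite -(ler_pM2l kk) avg.
have -> : \sum_(l < p.+1) (4 * s2 / k%:R ^+ 2) ^+ l / (l.*2)`!%:R * sum_nmoment H (p - l) k.+1
  = \sum_s \sum_(l < p.+1) (4 * s2 / k%:R ^+ 2 * 1 ^+ 2) ^+ l / (l.*2)`!%:R *
      nmoment (p - l) (T s - mu).
  rewrite exchange_big; apply: eq_bigr => l _.
  by rewrite /sum_nmoment mulr_sumr expr1n mulr1.
rewrite mulr_sumr; apply: ler_sum => s _; rewrite -[in leRHS](card_ord k.+1).
apply: mean_nmoment_le.
- rewrite linearB /= trmx_partial_mean // /mu linearZ /= linear_sum /=.
  by congr (_ - _ *: _); exact: eq_bigr.
- by move=> j; rewrite /D linearZ /= linearB /= trmx_partial_mean // hsym.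
- move=> j x; rewrite /D -scalemxAl frobZ mulmxBl.
  (* The constant 4 comes from [|T x - H x|^2 <= 2 (|T x|^2 + |H x|^2)]. *)
  have h1 := frob_sub_le (T s *m x) (H (s (widen_ord hk j)) *m x).
  have h2 := opbound_partial_mean s hH hk x.
  have h3 := hH (s (widen_ord hk j)) x.
  rewrite (_ : 4 * s2 / k%:R ^+ 2 * frob x = k%:R^-1 ^+ 2 * (4 * s2 * frob x)); last by field.
  rewrite ler_wpM2l ?sqr_ge0 //; move: h1 h2 h3; rewrite -/(T s); lra.
- by rewrite mulr_ge0 ?invr_ge0 ?sqr_ge0 // mulr_ge0.
- by rewrite -scaler_sumr sum_partial_mean scaler0.
- exact: ler01.
Qed.

(** * Comparison with Gaussian moments *)

Lemma fact_double_ge l : (2 ^ l * l`! <= (l.*2)`!)%N.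
Proof.
elim: l => // l IH; rewrite doubleS !factS expnS.
apply: (@leq_trans (2 * l.+1 * (2 ^ l * l`!))); first by nia.
by apply: (@leq_trans (l.*2.+2 * (l.*2)`!)); nia.
Qed.

(** A Gaussian of variance [v] has normalised even moments [(v / 2)^p / p!]. Adding an independent
    sign of size [sqrt c] costs no more than adding variance [c]: compare with the binomial
    expansion termwise, using [2^l l! <= (2l)!]. *)
Lemma even_exp_convolution_le (c v : R) p : 0 <= c -> 0 <= v ->
  \sum_(l < p.+1) c ^+ l / (l.*2)`!%:R * ((v / 2) ^+ (p - l) / (p - l)`!%:R) <=
  ((c + v) / 2) ^+ p / p`!%:R.
Proof.
move=> c0 v0.
rewrite mulrDl [_ + v / 2]addrC exprDn mulr_suml; apply: ler_sum => l _.
have lp : (l <= p)%N by rewrite -ltnS.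
have fR q : 0 < q`!%:R :> R by rewrite ltr0n fact_gt0.
apply: (@le_trans _ _ (c ^+ l / (2 ^+ l * l`!%:R) * ((v / 2) ^+ (p - l) / (p - l)`!%:R))).
  rewrite ler_wpM2r ?divr_ge0 ?exprn_ge0 ?divr_ge0 ?ler0n //.
  rewrite ler_wpM2l ?exprn_ge0 // lef_pV2 ?posrE ?mulr_gt0 ?exprn_gt0 //.
  by rewrite -natrX -natrM ler_nat fact_double_ge.
rewrite -[_ *+ 'C(p, l)]mulr_natr le_eqVlt; apply/orP; left; apply/eqP.
rewrite -(bin_fact lp) !natrM.
have b0 : 'C(p, l)%:R != 0 :> R by rewrite pnatr_eq0 -lt0n bin_gt0.
have := lt0r_neq0 (fR l); have := lt0r_neq0 (fR (p - l)%N).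
have : 2 ^+ l != 0 :> R by rewrite expf_neq0 // pnatr_eq0.
rewrite [(c / 2) ^+ l]exprMn exprVn; move: b0.
move: 'C(p, l)%:R (l`!%:R) ((p - l)`!%:R) (2 ^+ l : R) (c ^+ l) ((v / 2) ^+ _).
move=> b f g a x y b0 a0 g0 f0.
by field; rewrite a0 b0 f0 g0.
Qed.

(* Closed-form majorant of [sum_(k <= j < N) 4 s2 / j^2]; junk at [k = 0]. *)
Definition vproxy (s2 : R) N k : R :=
  4 * s2 * (k.+1%:R * (N%:R - k%:R) / (k%:R ^+ 2 * N%:R)).

Lemma vproxy_ge0 s2 N k : 0 <= s2 -> (k <= N)%N -> 0 <= vproxy s2 N k.
Proof.
move=> s0 kN; rewrite /vproxy !mulr_ge0 ?invr_ge0 ?mulr_ge0 ?sqr_ge0 ?ler0n //.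
by rewrite subr_ge0 ler_nat.
Qed.

Lemma vproxy_step s2 N k : 0 <= s2 -> (0 < k < N)%N ->
  4 * s2 / k%:R ^+ 2 + vproxy s2 N k.+1 <= vproxy s2 N k.
Proof.
move=> s0 /andP[k0 kN].
rewrite -subr_ge0 /vproxy -[k.+2%:R]natr1 -[k.+1%:R]natr1.
have : 0 <= N%:R - (k%:R + 1) :> R by rewrite natr1 subr_ge0 ler_nat.
have : 0 < k%:R :> R by rewrite ltr0n.
have : 0 < N%:R :> R by rewrite ltr0n; lia.
move: N%:R k%:R => y x y0 x0 xy.
(* The slack factors, and [k < N] settles the sign of its numerator. *)
rewrite (_ : _ - _ = 4 * s2 * ((y - (x + 1)) / (x * (x + 1) ^+ 2 * y))); last first.
  by field; rewrite (lt0r_neq0 x0) (lt0r_neq0 y0) lt0r_neq0 // ltr_wpDl // ltW.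
rewrite !mulr_ge0 ?invr_ge0 ?mulr_ge0 ?sqr_ge0 //; lra.
Qed.

(** Descending induction on [k]. At [k = N] the deviation is zero, so only the moment [p = 0]
    survives; it is the trace of the identity, whence the factor [n]. *)
Lemma sum_nmoment_le N n (H : 'I_N -> 'M[R]_n) s2 p k :
  (forall i, (H i)^T = H i) -> (forall i, opbound s2 (H i)) -> 0 <= s2 ->
  (0 < k <= N)%N ->
  sum_nmoment H p k <=
  #|{perm 'I_N}|%:R * n%:R * ((vproxy s2 N k / 2) ^+ p / p`!%:R).
Proof.
move=> hsym hH s0 /andP[k0 kN].
move: p; rewrite -(subKn kN); move: (leq_subr k N).
have : (N - k < N)%N by lia.
elim: (N - k)%N => [|i IH] iN _ p.
  rewrite subn0 /sum_nmoment; under eq_bigr do rewrite partial_mean_full subrr.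
  rewrite sumr_const -[leLHS]mulr_natl -mulrA ler_wpM2l //.
  rewrite /vproxy subrr mulr0 mul0r mulr0 mul0r /nmoment.
  case: p => [|p]; last by rewrite doubleS !exprS !mul0r mxtrace0 !mulr0.
  by rewrite !expr0 mxtrace1 fact0 invr1 mul1r !mulr1.
have kE : ((N - i.+1).+1 = N - i)%N by lia.
have hk : (0 < N - i.+1 < N)%N by lia.
move: hk kE; set k' := (N - i.+1)%N => hk kE.
apply: (le_trans (sum_nmoment_step p hsym hH s0 hk)); rewrite kE.
set c := 4 * s2 / _.
have c0 : 0 <= c by rewrite /c !mulr_ge0 ?invr_ge0 ?sqr_ge0.
have v0 : 0 <= vproxy s2 N (N - i) by rewrite vproxy_ge0 // leq_subr.
apply: (@le_trans _ _ (#|{perm 'I_N}|%:R * n%:R * (((c + vproxy s2 N (N - i)) / 2) ^+ p / p`!%:R))).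
  apply: le_trans (ler_wpM2l _ (even_exp_convolution_le p c0 v0)); last first.
    by rewrite mulr_ge0.
  rewrite mulr_sumr; apply: ler_sum => l _.
  rewrite mulrCA ler_wpM2l ?divr_ge0 ?exprn_ge0 ?ler0n //.
  by apply: IH; lia.
rewrite ler_wpM2l ?mulr_ge0 // ler_wpM2r ?invr_ge0 ?ler0n //.
apply: lerXn2r; rewrite ?nnegrE ?divr_ge0 ?addr_ge0 ?vproxy_ge0 ?leq_subr //.
by rewrite ler_wpM2r ?invr_ge0 // -kE vproxy_step.
Qed.

(** * Cauchy-Schwarz, trace powers and Hermitian dilations *)

Lemma frob_CauchySchwarz m n (X Y : 'M[R]_(m, n)) :
  \tr (X^T *m Y) ^+ 2 <= frob X * frob Y.
Proof.
set b := \tr _; have q t : 0 <= frob X - 2 * t * b + t ^+ 2 * frob Y.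
  have := frob_ge0 (X - t *: Y).
  by rewrite frobB -scalemxAr mxtraceZ frobZ -/b mulrA.
have := frob_ge0 Y; rewrite le_eqVlt => /orP[/eqP Y0|Y0].
  rewrite -Y0 mulr0; have [->|b0] := eqVneq b 0; first by rewrite expr0n.
  (* With [frob Y = 0] the quadratic is affine in [t], and this [t] would give it the value -1. *)
  have := q ((frob X + 1) / (2 * b)); rewrite -Y0 mulr0 addr0.
  by rewrite (_ : _ - _ = -1); [rewrite oppr_ge0 ler10 | field].
have := q (b / frob Y).
rewrite (_ : _ + _ = (frob X * frob Y - b ^+ 2) / frob Y); last by field; rewrite lt0r_neq0.
by rewrite pmulr_lge0 ?invr_gt0 // subr_ge0.
Qed.

Lemma frob_mulmx_col_le m n (A : 'M[R]_(m, n)) (x : 'cV[R]_n) :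
  frob (A *m x) <= frob A * frob x.
Proof.
have -> : frob A = \sum_i frob (row i A)^T.
  rewrite frobE exchange_big; apply: eq_bigr => i _; rewrite frobE big_ord1.
  by apply: eq_bigr => j _; rewrite !mxE.
rewrite frobE big_ord1 mulr_suml; apply: ler_sum => i _.
apply: le_trans (frob_CauchySchwarz _ _); rewrite trmxK.
by rewrite -row_mul [\tr _]big_ord1 [row _ _ _ _]mxE.
Qed.

(* Without eigenvalues: [a_j = |S^j x|^2] is log-convex with [a_0 <= 1], so
   [a_1^p <= a_p], which is at most the Frobenius norm of [S^p]. *)
Lemma frob_expr_le n (S : 'M[R]_n) (x : 'cV[R]_n) p : S^T = S -> frob x <= 1 ->
  frob (S *m x) ^+ p.+1 <= \tr (S ^+ p.+1.*2).
Proof.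
move=> hS x1; pose a j := frob (S ^+ j *m x).
have a0 j : 0 <= a j by exact: frob_ge0.
have ip i j : \tr ((S ^+ i *m x)^T *m (S ^+ j *m x)) = \tr (x^T *m S ^+ (i + j) *m x).
  by rewrite trmx_mul exprmx_sym // exprD -mulmxE !mulmxA.
have lc j : a j.+1 ^+ 2 <= a j * a j.+2.
  suff -> : a j.+1 = \tr ((S ^+ j *m x)^T *m (S ^+ j.+2 *m x)).
    exact: frob_CauchySchwarz.
  by rewrite /a /frob !ip addSnnS.
have inc j : a 1%N * a j <= a j.+1.
  elim: j => [|j IH].
    by rewrite -[leRHS]mulr1 ler_wpM2l //; rewrite /a expr0 mul1mx.
  have [z|nz] := eqVneq (a j.+1) 0; first by rewrite z mulr0.
  have p1 : 0 < a j.+1 by rewrite lt_def nz a0.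
  have pj : 0 < a j.
    rewrite lt_def a0 andbT; apply/eqP => z; have := lc j; rewrite z mul0r.
    by rewrite leNgt exprn_gt0.
  rewrite -(ler_pM2l pj); apply: le_trans (lc j).
  by rewrite expr2 mulrCA mulrA ler_wpM2r // mulrC.
have -> : \tr (S ^+ p.+1.*2) = frob (S ^+ p.+1).
  by rewrite /frob exprmx_sym // mulmxE -exprD addnn.
apply: (@le_trans _ _ (a p.+1)); last first.
  apply: le_trans (frob_mulmx_col_le _ _) _.
  by rewrite -[leRHS]mulr1 ler_wpM2l // frob_ge0.
have -> : S *m x = S ^+ 1 *m x by rewrite expr1.
rewrite -/(a 1%N); elim: p => [|p IH]; first by rewrite expr1.
by rewrite exprS; apply: le_trans (inc _); rewrite ler_wpM2l.
Qed.

Definition dilation m n (A : 'M[R]_(m, n)) : 'M[R]_(m + n) := block_mx 0 A A^T 0.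

Lemma dilation_sym m n (A : 'M[R]_(m, n)) : (dilation A)^T = dilation A.
Proof. by rewrite /dilation tr_block_mx !trmx0 trmxK. Qed.

Lemma dilationB m n (A B : 'M[R]_(m, n)) : dilation (A - B) = dilation A - dilation B.
Proof. by rewrite /dilation linearB /= opp_block_mx add_block_mx !subr0. Qed.

Lemma dilationZ m n a (A : 'M[R]_(m, n)) : dilation (a *: A) = a *: dilation A.
Proof. by rewrite /dilation linearZ /= scale_block_mx !scaler0. Qed.

Lemma dilation_sum m n (I : finType) (P : pred I) (A : I -> 'M[R]_(m, n)) :
  dilation (\sum_(i | P i) A i) = \sum_(i | P i) dilation (A i).
Proof.
apply: (big_morph (@dilation m n)); last by rewrite /dilation trmx0 block_mx0.
by move=> X Y; rewrite /dilation linearD /= add_block_mx !addr0.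
Qed.

Lemma frob_col_mx m n p (X : 'M[R]_(m, p)) (Y : 'M[R]_(n, p)) :
  frob (col_mx X Y) = frob X + frob Y.
Proof. by rewrite /frob tr_col_mx mul_row_col mxtraceD. Qed.

Lemma frob_dilation m n (A : 'M[R]_(m, n)) (x : 'cV[R]_n) :
  frob (dilation A *m col_mx 0 x) = frob (A *m x).
Proof.
rewrite /dilation mul_block_col !mulmx0 !mul0mx add0r addr0 frob_col_mx.
by rewrite [frob 0]/frob mulmx0 mxtrace0 addr0.
Qed.

(** The other block needs the bound for [A^T]: with [y = A^T u], Cauchy-Schwarz on
    [|y|^2 = <A y, u>] gives [|y|^4 <= s2 |y|^2 |u|^2]. *)
Lemma opbound_dilation m n (A : 'M[R]_(m, n)) s2 : 0 <= s2 ->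
  (forall x : 'cV[R]_n, frob (A *m x) <= s2 * frob x) -> opbound s2 (dilation A).
Proof.
move=> s0 hA x; rewrite -[x]vsubmxK; move: (usubmx x) (dsubmx x) => u v.
rewrite /dilation mul_block_col !mul0mx add0r addr0 !frob_col_mx mulrDr addrC.
apply: lerD; last exact: hA.
set y := A^T *m u; have := frob_ge0 y; rewrite le_eqVlt => /orP[/eqP <-|y0].
  by rewrite mulr_ge0 // frob_ge0.
rewrite -(ler_pM2l y0).
have e : frob y = \tr ((A *m y)^T *m u) by rewrite trmx_mul -mulmxA.
rewrite -expr2 {1}e; apply: le_trans (frob_CauchySchwarz _ _) _.
by rewrite mulrCA mulrA ler_wpM2r ?frob_ge0 // hA.
Qed.

Lemma dilation_partial_mean N m n (B : 'I_N -> 'M[R]_(m, n)) k s :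
  dilation (partial_mean B k s) = partial_mean (fun i => dilation (B i)) k s.
Proof. by rewrite /partial_mean dilationZ dilation_sum. Qed.

(* The [2p]-th moment of the norm is at most [m + n] times that
   of a centered Gaussian of variance [vproxy]. *)
Lemma count_norm_ge_le N m n (B : 'I_N -> 'M[R]_(m, n)) s2 k (E : pred {perm 'I_N}) e2 p :
  0 <= s2 -> (forall i (x : 'cV[R]_n), frob (B i *m x) <= s2 * frob x) ->
  (0 < k <= N)%N ->
  (forall s, E s -> e2 ^+ p <=
     \tr (dilation (partial_mean B k s - N%:R^-1 *: \sum_i B i) ^+ p.*2)) ->
  #|E|%:R * (e2 ^+ p / (p.*2)`!%:R) <=
  #|{perm 'I_N}|%:R * (m + n)%:R * ((vproxy s2 N k / 2) ^+ p / p`!%:R).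
Proof.
move=> s0 hB hk hE.
have hH i : opbound s2 (dilation (B i)) by exact: opbound_dilation.
apply: le_trans (sum_nmoment_le p (fun i => dilation_sym (B i)) hH s0 hk).
(* Markov's inequality: permutations outside [E] contribute nonnegative even moments. *)
rewrite mulr_natl -sumr_const /sum_nmoment big_mkcond /=; apply: ler_sum => s _.
rewrite -dilation_partial_mean -dilation_sum -dilationZ -dilationB /nmoment.
case: ifP => [Es|_].
  by rewrite mulrC ler_wpM2l ?invr_ge0 ?ler0n // hE.
rewrite mulr_ge0 ?invr_ge0 ?ler0n // -addnn exprD -{1}exprmx_sym ?dilation_sym //.
exact: frob_ge0.
Qed.

End MatrixMoments.

(** * The spectral norm *)

Section SpectralNorm.
Local Open Scope ring_scope.

Definition mx_of_rmat m n (A : rmat m n) : 'M[R]_(m, n) := \matrix_(i, j) A i j.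
Definition cV_of_rvec n (x : rvec n) : 'cV[R]_n := \col_i x i.

Lemma mx_of_rmatB m n (A B : rmat m n) :
  mx_of_rmat (mx_sub A B) = mx_of_rmat A - mx_of_rmat B.
Proof. by apply/matrixP => i j; rewrite !mxE. Qed.

Lemma mx_of_mx_mean N m n (A : 'I_N -> rmat m n) :
  mx_of_rmat (mx_mean A) = N%:R^-1 *: \sum_i mx_of_rmat (A i).
Proof.
apply/matrixP => i j; rewrite !mxE /mx_mean /rsum summxE INRE RinvE RmultE.
by congr (_ * _); apply: eq_bigr => k _; rewrite mxE.
Qed.

Lemma mx_of_sample_mean N m n k (A : 'I_N -> rmat m n) s :
  mx_of_rmat (sample_mean k A s) = partial_mean (fun i => mx_of_rmat (A i)) k s.
Proof.
apply/matrixP => i j; rewrite !mxE /sample_mean summxE INRE RinvE RmultE.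
by congr (_ * _); apply: eq_bigr => l _; rewrite mxE.
Qed.

Lemma vnorm_sqr n (x : rvec n) : vnorm x ^+ 2 = frob (cV_of_rvec x).
Proof.
rewrite /vnorm RsqrtE sqr_sqrtr.
  by rewrite frobE big_ord1; apply: eq_bigr => i _; rewrite mxE RpowE.
by apply: sumr_ge0 => i _; rewrite RpowE sqr_ge0.
Qed.

Lemma vnorm_ge0 n (x : rvec n) : 0 <= vnorm x.
Proof. by rewrite /vnorm RsqrtE sqrtr_ge0. Qed.

Lemma cV_of_mxv m n (A : rmat m n) x :
  cV_of_rvec (mxv A x) = mx_of_rmat A *m cV_of_rvec x.
Proof.
by apply/matrixP => i j; rewrite !mxE /mxv; apply: eq_bigr => k _; rewrite !mxE.
Qed.

Lemma vnorm_le1 n (x : rvec n) : (vnorm x <= 1) = (frob (cV_of_rvec x) <= 1).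
Proof. by rewrite -vnorm_sqr expr_le1 // vnorm_ge0. Qed.

(** The default value of [Rsup] is never taken: the zero vector gives an element, and
    [r^2 <= frob A] forces [r <= frob A + 1]. *)
Lemma specnorm_is_lub m n (A : rmat m n) :
  is_lub (fun r => exists x : rvec n, Rle (vnorm x) 1 /\ r = vnorm (mxv A x)) (specnorm A).
Proof.
rewrite /specnorm /Rsup; case: excluded_middle_informative => [h|[]]; first exact: proj2_sig.
have [||l hl] := completeness (fun r => exists x : rvec n, Rle (vnorm x) 1 /\ r = vnorm (mxv A x)).
- exists (frob (mx_of_rmat A) + 1) => r [x [/RleP x1 ->]]; apply/RleP.
  rewrite vnorm_le1 in x1.
  have := frob_mulmx_col_le (mx_of_rmat A) (cV_of_rvec x).
  rewrite -cV_of_mxv -(vnorm_sqr (mxv A x)).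
  have := frob_ge0 (mx_of_rmat A); nra.
- exists (vnorm (mxv A (fun=> 0))), (fun=> 0); split=> //; apply/RleP.
  rewrite vnorm_le1 frobE big_ord1 big1 // => i _.
  by rewrite mxE expr0n.
- by exists l.
Qed.

Lemma specnorm_le_frob m n (A : rmat m n) sigma (x : 'cV[R]_n) :
  specnorm A <= sigma -> frob (mx_of_rmat A *m x) <= sigma ^+ 2 * frob x.
Proof.
move=> hA; have := frob_ge0 x; rewrite le_eqVlt => /orP[/eqP x0|x0].
  rewrite -x0 mulr0; apply: le_trans (frob_mulmx_col_le _ _) _.
  by rewrite -x0 mulr0.
pose c := Num.sqrt (frob x).
have c0 : 0 < c by rewrite sqrtr_gt0.
have c2 : c ^+ 2 = frob x by rewrite sqr_sqrtr // ltW.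
pose y : rvec n := fun i => c^-1 * x i ord0.
have yE : cV_of_rvec y = c^-1 *: x by apply/matrixP => i j; rewrite !mxE ord1.
have y1 : Rle (vnorm y) 1; first apply/RleP.
  by rewrite vnorm_le1 yE frobZ -c2 -exprMn mulVf ?lt0r_neq0 // expr1n.
have [ub _] := specnorm_is_lub A.
have /RleP := ub _ (ex_intro _ y (conj y1 erefl)).
move=> /le_trans /(_ hA) hy.
have := lerXn2r 2 (vnorm_ge0 _) (le_trans (vnorm_ge0 _) hy) hy.
rewrite vnorm_sqr cV_of_mxv yE -scalemxAr frobZ -c2 exprVn mulrC.
by rewrite ler_pdivrMr ?exprn_gt0.
Qed.

Lemma pow_root (t : R) k : 0 < t -> exists2 b : R, 0 < b & b ^+ k.+1 = t.
Proof.
move=> /RltP t0; exists (Rpower t (/ INR k.+1)); first by apply/RltP; exact: exp_pos.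
rewrite -RpowE -Rpower_pow; last exact: exp_pos.
by rewrite Rpower_mult Rinv_l ?Rpower_1 //; exact: not_0_INR.
Qed.

(** To avoid a maximizing vector, take the root [b] of the trace: every value on the unit ball is at
    most [b], hence so is the supremum. *)
Lemma specnorm_ge_trace m n (A : rmat m n) eps p : 0 < eps -> eps <= specnorm A ->
  (eps ^+ 2) ^+ p <= \tr (dilation (mx_of_rmat A) ^+ p.*2).
Proof.
move=> e0 hA; have [_ lub] := specnorm_is_lub A.
have dil_le x q : vnorm x <= 1 ->
    vnorm (mxv A x) ^+ q.+1.*2 <= \tr (dilation (mx_of_rmat A) ^+ q.+1.*2).
  move=> x1; rewrite -mul2n exprM vnorm_sqr cV_of_mxv -frob_dilation mul2n.
  apply: frob_expr_le; first exact: dilation_sym.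
  by rewrite frob_col_mx [frob 0]/frob mulmx0 mxtrace0 add0r -vnorm_le1.
have spec_le b : (forall x, vnorm x <= 1 -> vnorm (mxv A x) <= b) -> specnorm A <= b.
  by move=> hb; apply/RleP/lub => r [x [/RleP x1 ->]]; apply/RleP/hb.
have nspec0 : ~~ (specnorm A <= 0) by rewrite -ltNge (lt_le_trans e0).
case: p => [|p].
  (* At [p = 0] the trace is [m + n]; were it zero, the norm could not be positive. *)
  rewrite !expr0 mxtrace1 (_ : 1 = 1%:R) // ler_nat lt0n.
  apply: contraNneq nspec0 => mn0; apply: spec_le => x _.
  rewrite -(@ler_pXn2r _ 2) ?nnegrE ?vnorm_ge0 // vnorm_sqr frobE big_ord1 expr0n.
  rewrite big1 // => -[i hi]; exfalso; by move: hi; lia.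
have : 0 <= \tr (dilation (mx_of_rmat A) ^+ p.+1.*2).
  rewrite -addnn exprD -{1}exprmx_sym ?dilation_sym //; exact: frob_ge0.
rewrite le_eqVlt => /orP[/eqP t0|t0].
  case/negP: nspec0; apply: spec_le => x /(dil_le x p); rewrite -t0.
  have := vnorm_ge0 (mxv A x); rewrite le_eqVlt => /orP[/eqP <- //|v0].
  by rewrite leNgt exprn_gt0.
have [b b0 bE] := pow_root (p.*2.+1) t0.
have sb : specnorm A <= b.
  apply: spec_le => x /(dil_le x p); rewrite -bE -doubleS.
  by rewrite ler_pXn2r ?nnegrE ?vnorm_ge0 // ltW.
rewrite -exprM mul2n -bE -doubleS ler_pXn2r ?nnegrE ?(ltW e0) ?(ltW b0) //.
exact: le_trans hA sb.
Qed.
End SpectralNorm.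

(** * The tail bound for the sample mean *)

Theorem theorem4 (N d1 d2 n : nat) (A : 'I_N -> rmat d1 d2) (sigma eps : R)
  (hsig : 0 < sigma) (hA : forall i, specnorm (A i) <= sigma)
  (hn1 : (1 <= n)%N) (hnN : (n < N)%N) (heps : 0 < eps) :
  perm_prob (fun s : {perm 'I_N} =>
      specnorm (mx_sub (sample_mean n A s) (mx_mean A)) >= eps)
  <= 2 * INR (d1 + d2) *
     exp (- (INR n * eps ^ 2) /
          (8 * sigma ^ 2 * (1 + / INR n) * (1 - INR n / INR N))).
Proof.
have IZR2 : IZR 2 = 2%:R%R by rewrite -INRE INR_IZR_INZ.
have IZR4 : IZR 4 = 4%:R%R by rewrite -INRE INR_IZR_INZ.
have n0 : 0 < INR n by apply: lt_0_INR; apply/ssrnat.ltP.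
have nN : INR n < INR N by apply: lt_INR; apply/ssrnat.ltP.
have [v0 ->] := exponent_vproxy (eps ^ 2) (conj n0 nN) (pow_lt _ 2 hsig).
rewrite (_ : 4 * sigma ^ 2 * _ = vproxy (GRing.exp sigma 2) N n) in v0 *; last first.
  by rewrite /vproxy -[(n.+1%:R)%R]natr1 !RpowE !INRE IZR4.
have card0 : 0 < INR #|{perm 'I_N}|.
  by apply: lt_0_INR; apply/ssrnat.ltP/card_gt0P; exists 1%g.
apply: gaussian_moments_tail => //; [ | exact: pos_INR | ].
  by apply: Rmult_le_pos; [exact: pos_INR | exact/Rlt_le/Rinv_0_lt_compat].
move=> p; rewrite /perm_prob; set E := [set s | _].
(* Multiplying by [N!] turns the probability into the count bounded by [count_norm_ge_le]. *)
apply: (Rmult_le_reg_l _ _ _ card0).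
apply/RleP; rewrite !RpowE !factE !INRE IZR2 !RdivE !RmultE.
have c0 : (#|{perm 'I_N}|%:R != 0 :> R)%R.
  by rewrite -INRE; apply/eqP; exact: Rgt_not_eq.
rewrite [leRHS]mulrA [leLHS]mulrA [X in (X * _ <= _)%R]mulrCA mulfV // mulr1.
apply: (@count_norm_ge_le _ N d1 d2 (fun i => mx_of_rmat (A i))).
- exact: sqr_ge0.
- by move=> i x; apply: specnorm_le_frob; apply/RleP.
- by rewrite hn1 ltnW.
- move=> s Es; have : s \in E by [].
  rewrite inE /asb; case: excluded_middle_informative => // hs _.
  rewrite -mx_of_sample_mean -mx_of_mx_mean -mx_of_rmatB.
  by apply: specnorm_ge_trace; apply/RltP || apply/RleP/Rge_le.
Qed.
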